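(* Let $f:I\to I$ be a topologically mixing piecewise linear expanding Markov map with Markov partition $\{I_1,\dots,I_N\}$ and slopes $\gamma_1,\dots,\gamma_N$. Let $D_r\subset D_R$ be concentric open disks in $\mathbb{C}$ of radii $0<r<R$ such that $\varphi_{kl}(D_R)\subset D_r$ for all inverse branches $\varphi_{kl}$ of $f$, and let $\mathcal{H}=\mathcal{H}(D_R)$ be the associated space of piecewise analytic observables. Let $\mu$ be the $f$-invariant Borel probability measure on $I$ whose density with respect to Lebesgue measure is constant on the interior of each $I_k$, and let $\Lambda=\int_I \ln|f'(x)|\,d\mu(x)$ be the Lyapunov exponent of $f$ with respect to $\mu$. Then the mixing rate $\alpha_{\mathcal{H}}$ (defined with respect to $\mu$) satisfies $$\alpha_{\mathcal{H}}\le 2\Lambda .$$ If, moreover, all slopes $\gamma_1,\dots,\gamma_N$ have the same sign, then $$\alpha_{\mathcal{H}}\le \Lambda .$$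
   Context: **Partitions and Markov maps.** $I$ is a compact interval of positive length. A partition of $I$ is a finite collection $\{I_1,\dots,I_N\}$ of closed intervals of positive length with pairwise disjoint interiors and $\bigcup_{k=1}^N I_k=I$. A map $f:I\to I$ is a Markov map if there is a partition $\{I_k\}_{k=1}^N$ of $I$ (a Markov partition) such that for every pair $(k,l)$ either $f(\mathrm{int}(I_k))\cap \mathrm{int}(I_l)=\emptyset$ or $\mathrm{int}(I_l)\subseteq f(\mathrm{int}(I_k))$. Its topological transition matrix is the $N\times N$ matrix $A$ with $A_{kl}=1$ if $\mathrm{int}(I_l)\subseteq f(\mathrm{int}(I_k))$ and $A_{kl}=0$ otherwise. A Markov map is expanding if $|f'(x)|>1$ for all $x\in\mathrm{int}(I_k)$ and all $k$. It is piecewise linear if for each $k$ there is a constant $\gamma_k$ (the slope) with $f'(x)=\gamma_k$ for all $x\in \mathrm{int}(I_k)$; thus $f(x)=\gamma_k x+d_k$ on $\mathrm{int}(I_k)$ for some $d_k\in\mathbb{R}$. An expanding Markov map is called topologically mixing if there is a positive integer $p$ such that every entry of $A^p$ is strictly positive. **Inverse branches.** For each $(k,l)$ with $A_{lk}=1$, $\varphi_{kl}:I_k\to I_l$ is the inverse branch of $f$ from $I_k$ into $I_l$, i.e. $\varphi_{kl}(x)=(x-d_l)/\gamma_l$, also regarded as an affine map of $\mathbb{C}$. **Observables.** For an open disk $D\subset\mathbb{C}$, $H^\infty(D)$ is the Banach space of bounded holomorphic functions $h:D\to\mathbb{C}$ with the supremum norm, and $\mathcal{H}(D)=\bigoplus_{k=1}^N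 H^\infty(D)$ is the space of $N$-tuples $(h_1,\dots,h_N)$ with norm $\max_k\|h_k\|_{H^\infty(D)}$. An element $(h_1,\dots,h_N)\in\mathcal{H}(D_R)$ is viewed as an observable on $I$ that equals $h_k$ on $\mathrm{int}(I_k)$; values at the finitely many endpoints of the partition are disregarded. **Correlations and mixing rate.** For observables $\varphi,\psi$ and $n\ge 0$ put $$C_{\varphi,\psi}(n)=\int_I \varphi(f^n(x))\psi(x)\,d\mu-\int_I\varphi\,d\mu\int_I\psi\,d\mu ,$$ $$\alpha_{\varphi,\psi}=\sup\{s : \limsup_{n\to\infty}|\exp(sn)\,C_{\varphi,\psi}(n)|<\infty\},$$ and, for a linear space $\mathcal{H}$ of observables, define the mixing rate $\alpha_{\mathcal{H}}=\inf\{\alpha_{\varphi,\psi}:\varphi,\psi\in\mathcal{H}\}$. *)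

(* Defs.v *)
From mathcomp Require Import all_boot all_order all_algebra.
From mathcomp Require Import complex.
From mathcomp Require Import all_classical all_reals all_analysis.

Set Implicit Arguments.
Unset Strict Implicit.
Unset Printing Implicit Defensive.

Import Order.TTheory GRing.Theory Num.Theory.
Import numFieldNormedType.Exports.

Local Open Scope classical_set_scope.
Local Open Scope complex_scope.
Local Open Scope ring_scope.

Definition cell (R : realType) (N : nat) (u v : 'I_N -> R) (k : 'I_N) : set R :=
  [set` `[u k, v k]].

Definition int_cell (R : realType) (N : nat) (u v : 'I_N -> R) (k : 'I_N) :
    set R :=
  (cell u v k)°.

Definition is_partition (R : realType) (I : set R) (N : nat)
    (u v : 'I_N -> R) : Prop :=
  [/\ forall k, u k < v k,
      trivIset [set: 'I_N] (int_cell u v)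
    & \bigcup_(k in [set: 'I_N]) cell u v k = I].

Definition is_markov_partition (R : realType) (I : set R) (f : R -> R) (N : nat)
    (u v : 'I_N -> R) : Prop :=
  is_partition I u v /\
  forall k l, f @` int_cell u v k `&` int_cell u v l = set0 \/
              int_cell u v l `<=` f @` int_cell u v k.

Definition transition_matrix (R : realType) (f : R -> R) (N : nat)
    (u v : 'I_N -> R) : 'M[int]_N :=
  \matrix_(k, l) (`[< int_cell u v l `<=` f @` int_cell u v k >])%:R.

Definition expanding (R : realType) (f : R -> R) (N : nat)
    (u v : 'I_N -> R) : Prop :=
  forall k x, int_cell u v k x -> derivable f x 1 /\ 1 < `|f^`()%classic x|.

Definition piecewise_linear (R : realType) (f : R -> R) (N : nat)
    (u v gamma : 'I_N -> R) : Prop :=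
  forall k x, int_cell u v k x -> derivable f x 1 /\ f^`()%classic x = gamma k.

Definition is_intercept (R : realType) (f : R -> R) (N : nat)
    (u v gamma d : 'I_N -> R) : Prop :=
  forall k x, int_cell u v k x -> f x = gamma k * x + d k.

Definition topologically_mixing (R : realType) (f : R -> R) (N : nat)
    (u v : 'I_N -> R) : Prop :=
  exists2 p : nat, (0 < p)%N &
    forall k l, 0 < (transition_matrix f u v ^+ p) k l.

Definition inverse_branch (R : realType) (N : nat) (gamma d : 'I_N -> R)
    (l : 'I_N) (z : R[i]) : R[i] :=
  (z - (d l)%:C) / (gamma l)%:C.

(* The order on R[i] compares only numbers with equal imaginary parts, so the
   bound on |h z| below says that it is at most the real number M. *)
Definition Hinfty (R : realType) (D : set R[i]) : set (R[i] -> R[i]) :=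
  [set h | (forall z, D z -> derivable (h : R[i]^o -> R[i]^o) z 1) /\
           exists M : R, forall z, D z -> `|h z| <= M%:C].

(* The interiors of the cells are disjoint, so at most one term occurs in the
   sum; at an endpoint of the partition the value is 0. *)
Definition piecewise (R : realType) (N : nat) (u v : 'I_N -> R)
    (h : 'I_N -> R[i] -> R[i]) (x : R) : R[i] :=
  \sum_(k < N | x \in int_cell u v k) h k x%:C.

Definition analytic_observables (R : realType) (N : nat) (u v : 'I_N -> R)
    (D : set R[i]) : set (R -> R[i]) :=
  [set piecewise u v h | h in [set h | forall k, Hinfty D (h k)]].

Definition has_piecewise_constant_density (R : realType) (I : set R) (N : nat)
    (u v : 'I_N -> R) (mu : set (measurableTypeR R) -> \bar R) : Prop :=
  exists rho : R -> R,
    [/\ measurable_fun I rho, forall x, I x -> 0 <= rho x,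
        forall k, exists w, forall x, int_cell u v k x -> rho x = w
      & forall B : set (measurableTypeR R), measurable B -> B `<=` I ->
          mu B = (\int[lebesgue_measure]_(x in B) (rho x)%:E)%E].

(* The map f is only meaningful on I, hence the intersection. *)
Definition invariant_on (R : realType) (I : set R) (f : R -> R)
    (mu : set (measurableTypeR R) -> \bar R) : Prop :=
  forall B : set (measurableTypeR R), measurable B -> B `<=` I ->
    mu (I `&` f @^-1` B) = mu B.

Definition Cintegral (R : realType)
    (mu : {measure set (measurableTypeR R) -> \bar R}) (I : set R)
    (g : R -> R[i]) : R[i] :=
  (\int[mu]_(x in I) complex.Re (g x)) +i*
  (\int[mu]_(x in I) complex.Im (g x)).

Definition correlation (R : realType)
    (mu : {measure set (measurableTypeR R) -> \bar R}) (I : set R) (f : R -> R)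
    (phi psi : R -> R[i]) (n : nat) : R[i] :=
  Cintegral mu I (fun x => phi (iter n f x) * psi x)
  - Cintegral mu I phi * Cintegral mu I psi.

(* Extended real: it is +oo when the correlations vanish for all large n. *)
Definition decay_rate (R : realType)
    (mu : {measure set (measurableTypeR R) -> \bar R}) (I : set R) (f : R -> R)
    (phi psi : R -> R[i]) : \bar R :=
  ereal_sup [set s%:E | s in [set s : R |
    (limn_esup (fun n =>
       (complex.Re `|(expR (s * n%:R))%:C * correlation mu I f phi psi n|)%:E)
     < +oo)%E]].

Definition mixing_rate (R : realType)
    (mu : {measure set (measurableTypeR R) -> \bar R}) (I : set R) (f : R -> R)
    (H : set (R -> R[i])) : \bar R :=
  ereal_inf [set decay_rate mu I f p.1 p.2 | p in H `*` H].

Definition lyapunov (R : realType)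
    (mu : {measure set (measurableTypeR R) -> \bar R}) (I : set R)
    (f : R -> R) : R :=
  \int[mu]_(x in I) ln `|f^`()%classic x|.

(* Main.v *)
Require Import Defs.
From mathcomp Require Import all_boot all_order all_algebra.
From mathcomp Require Import complex.
From mathcomp Require Import all_classical all_reals all_analysis.
From mathcomp Require Import measurable_realfun ring lra.
Import Order.TTheory GRing.Theory Num.Theory.
Import numFieldNormedType.Exports.
Local Open Scope classical_set_scope.
Local Open Scope complex_scope.
Local Open Scope ring_scope.

Set Implicit Arguments.
Unset Strict Implicit.
Unset Printing Implicit Defensive.

(** Both bounds come from one explicit pair of observables, for which the
    correlations can be bounded below at every time [n].

    Fix a degree [j > 0]. On each cell let [phi] be the Legendre polynomial of
    degree [j], normalized so that integrating it against a polynomial of degree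
    at most [j] returns the coefficient of degree [j] times the length of the
    cell ([dual_weight]), and let [psi] be the monomial of degree [j]. The map
    [f^n] is affine with some slope G on each cylinder of order [n], and it maps
    this cylinder onto a cell. After the change of variables [y = f^n x] the
    monomial [psi] becomes a polynomial in [y] with top coefficient G^-j, and
    [phi] sees nothing but this coefficient. As [phi] has mean zero, summing
    over the cylinders gives

      C(n) = integral of ((f^n)')^-j with respect to mu.

    The cylinders need not be enumerated: the duality of [phi] is preserved by
    composition with [f], by a formula over one step ([dual_weight_comp], which
    rests on [Rintegral_transfer]), and the iteration takes place on vectors
    indexed by the cells.

    If the [j]-th powers of the slopes all have the same sign, the integrand has
    constant sign, and by Jensen's inequality and the invariance of [mu]

      |C(n)| >= exp(- j * integral of ln |(f^n)'|) = exp(- j n Lambda)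

    ([correlation_lower_bound]). In the cellwise description this is a statement
    on the stationary Markov chain of itineraries of [mu]
    ([discounted_stationary_ge]). Hence the decay rate of this pair, and with it
    the mixing rate, is at most [j * Lambda] ([mixing_rate_le_lyapunov]).
    Squares are positive, so [j = 2] always qualifies, and [j = 1] does when the
    slopes have the same sign. *)

(** * Integrals of bounded measurable functions *)

Section BoundedMeasurable.
Context (R : realType).
Implicit Types (D : set (measurableTypeR R)) (g h : R -> R).

(** The class of weights integrated below: it is stable under the algebraic
    operations and under composition with the map, and on a set of finite
    measure it gives integrability at once. *)
Definition bounded_measurable D g : Prop :=
  measurable_fun D (g : measurableTypeR R -> R) /\
  exists M, forall x, D x -> `|g x| <= M.

Lemma bounded_measurable_cst D c : bounded_measurable D (fun=> c).
Proof. by split; [exact: measurable_cst | exists `|c|]. Qed.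

Lemma bounded_measurableD D g h : bounded_measurable D g ->
  bounded_measurable D h -> bounded_measurable D (fun x => g x + h x).
Proof.
move=> [mg [M gM]] [mh [M' hM]]; split; first exact: measurable_funD.
by exists (M + M') => x Dx; rewrite (le_trans (ler_normD _ _))// lerD ?gM ?hM.
Qed.

Lemma bounded_measurableM D g h : bounded_measurable D g ->
  bounded_measurable D h -> bounded_measurable D (fun x => g x * h x).
Proof.
move=> [mg [M gM]] [mh [M' hM]]; split; first exact: measurable_funM.
by exists (M * M') => x Dx; rewrite normrM ler_pM ?gM ?hM.
Qed.

Lemma bounded_measurable_sum D (I : Type) (s : seq I) (F : I -> R -> R) :
  (forall i, bounded_measurable D (F i)) ->
  bounded_measurable D (fun x => \sum_(i <- s) F i x).
Proof.
move=> bF; elim: s => [|i s ih].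
  by under eq_fun do rewrite big_nil; exact: bounded_measurable_cst.
by under eq_fun do rewrite big_cons; exact: bounded_measurableD.
Qed.

Lemma bounded_measurable_indic D A : measurable A ->
  bounded_measurable D (\1_A : R -> R).
Proof.
move=> mA; split; first exact: measurable_indic.
by exists 1 => x _; rewrite indicE; case: (_ \in _); rewrite ?normr0 ?normr1.
Qed.

Lemma bounded_measurableS D D' g : measurable D' -> D `<=` D' ->
  bounded_measurable D' g -> bounded_measurable D g.
Proof.
move=> mD' DD' [mg [M gM]]; split; first exact: measurable_funS mg.
by exists M => x /DD'; exact: gM.
Qed.

Lemma bounded_measurable_eq D g h : (forall x, D x -> g x = h x) ->
  bounded_measurable D g -> bounded_measurable D h.
Proof.
move=> gh [mg [M gM]]; split; last by exists M => x Dx; rewrite -gh ?gM.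
by apply: eq_measurable_fun mg => x /set_mem /gh.
Qed.

Lemma bounded_measurable_id (a b : R) : bounded_measurable `[a, b] id.
Proof.
split; first exact: measurable_id.
exists (`|a| + `|b|) => x; rewrite /= in_itv/= => /andP[ax xb].
rewrite ler_norml; apply/andP; split.
  apply: le_trans ax; rewrite lerNl -normrN (le_trans (ler_norm _))//.
  by rewrite lerDl.
by apply: le_trans xb _; rewrite (le_trans (ler_norm _))// lerDr.
Qed.

Lemma bounded_measurable_horner D (p : {poly R}) : bounded_measurable D id ->
  bounded_measurable D (horner p).
Proof.
move=> bid; elim/poly_ind: p => [|p c ih].
  by rewrite horner0_ext; exact: bounded_measurable_cst.
rewrite hornerD_ext horner_scale_ext hornerC_ext.
apply: bounded_measurableD; last exact: bounded_measurable_cst.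
exact: bounded_measurableM.
Qed.

Lemma bounded_measurable_comp D D' g h : measurable D' ->
  measurable_fun D (h : measurableTypeR R -> measurableTypeR R) ->
  (forall x, D x -> D' (h x)) ->
  bounded_measurable D' g -> bounded_measurable D (fun x => g (h x)).
Proof.
move=> mD' mh hD [mg [M gM]]; split; last by exists M => x /hD; exact: gM.
by apply: (measurable_comp mD') => // _ [x Dx <-]; exact: hD.
Qed.

Lemma bounded_measurable_patch D g : measurable D -> bounded_measurable D g ->
  bounded_measurable setT (g \_ D).
Proof.
move=> mD [mg [M gM]]; split; first exact/(measurable_restrictT g mD).
exists (Num.max 0 M) => x _; rewrite /patch le_max.
case: ifPn => [/set_mem/gM->|_].
  by rewrite orbT.
by rewrite normr0 lexx.
Qed.

Lemma bounded_measurable_integrable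
    (m : {measure set (measurableTypeR R) -> \bar R}) D g :
  measurable D -> (m D < +oo)%E -> bounded_measurable D g ->
  m.-integrable D (EFin \o g).
Proof.
move=> mD Dfin [mg [M gM]]; apply: measurable_bounded_integrable => //.
exists M; split; first exact: num_real.
by move=> M' MM' x Dx /=; exact: le_trans (gM x Dx) (ltW MM').
Qed.

End BoundedMeasurable.

Section ChangeOfMeasure.
Context (R : realType).
Implicit Types (D : set (measurableTypeR R)) (g : R -> R).

(** Serves twice: for the affine image of Lebesgue measure, and for an
    invariant measure with constant density on a cell. *)
Lemma Rintegral_proportional
    (m1 m2 : {measure set (measurableTypeR R) -> \bar R}) D g (w : R) :
  0 <= w -> measurable D -> m2.-integrable D (EFin \o g) ->
  (forall B, measurable B -> B `<=` D -> m1 B = (w%:E * m2 B)%E) ->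
  \int[m1]_(x in D) g x = w * \int[m2]_(x in D) g x.
Proof.
move=> w0 mD ig m12; rewrite /Rintegral.
rewrite (eq_measure_integral (mscale (NngNum w0) m2))//=.
have mg := measurable_int _ ig.
rewrite [in LHS]integralE [in RHS]integralE.
rewrite !ge0_integral_mscale//=;
  [|exact: measurable_funeneg|exact: measurable_funepos].
have := integrable_pos_fin_num mD ig; have := integrable_neg_fin_num mD ig.
move=> /fineK <- /fineK <-.
by rewrite -!EFinM -!EFinB/= mulrBr.
Qed.

Lemma measurable_affine (s t : R) :
  measurable_fun setT
    ((fun x => s * x + t) : measurableTypeR R -> measurableTypeR R).
Proof.
apply: measurable_funD; last exact: measurable_cst.
by apply: measurable_funM;
  [exact: measurable_cst | exact: measurable_id].
Qed.

(** By uniqueness of Lebesgue measure, this only has to be checked on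
    half-open intervals; a negative slope turns ]p, q] into an interval of the
    opposite kind, which has the same length. *)
Lemma lebesgue_measure_affine_preimage (s t : R) D :
  s != 0 -> measurable D ->
  lebesgue_measure D =
    (`|s|%:E * lebesgue_measure ((fun x => s * x + t)%R @^-1` D))%E.
Proof.
move=> s0 mD.
pose pf : {measure set (measurableTypeR R) -> \bar R} :=
  measure_function_pushforward__canonical__measure_function_Measure
    lebesgue_measure (measurable_affine s t).
rewrite (@lebesgue_measure_unique R (mscale (NngNum (normr_ge0 s)) pf))//.
move=> _ [[p q] _ <-] /=; rewrite /mscale/= /pushforward.
move: s0; rewrite neq_lt => /orP[s0|s0].
- have -> : (fun x => s * x + t) @^-1` `]p, q] =
            `[(q - t) / s, (p - t) / s[%classic.
    apply/seteqP; split => x /=; rewrite !in_itv/=;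
    by rewrite ler_ndivrMr// ltr_ndivlMr// andbC -ltrBlDr -lerBrDr
      ![_ * s]mulrC.
  rewrite !lebesgue_measure_itv/= !lte_fin ltr_ndivlMr// divfK ?lt_eqF//.
  rewrite ltrD2r; case: ifPn => pq; last by rewrite mule0.
  rewrite -!EFinD -EFinM ltr0_norm//; congr (_%:E).
  by field; rewrite lt_eqF.
- have -> : (fun x => s * x + t) @^-1` `]p, q] =
            `](p - t) / s, (q - t) / s]%classic.
    apply/seteqP; split => x /=; rewrite !in_itv/=;
    by rewrite ler_pdivlMr// ltr_pdivrMr// -ltrBlDr -lerBrDr ![_ * s]mulrC.
  rewrite !lebesgue_measure_itv/= !lte_fin ltr_pdivrMr// divfK ?gt_eqF//.
  rewrite ltrD2r; case: ifPn => pq; last by rewrite mule0.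
  rewrite -!EFinD -EFinM gtr0_norm//; congr (_%:E).
  by field; rewrite gt_eqF.
Qed.

Lemma Rintegral_affine (s t : R) D g : s != 0 -> measurable D ->
  (lebesgue_measure D < +oo)%E -> bounded_measurable setT g ->
  \int[lebesgue_measure]_(x in (fun x => s * x + t) @^-1` D) g (s * x + t) =
  `|s|^-1 * \int[lebesgue_measure]_(x in D) g x.
Proof.
move=> s0 mD Dfin bg.
have ns0 : 0 < `|s| by rewrite normr_gt0.
have mh := measurable_affine s t.
have mhD : measurable ((fun x : measurableTypeR R => s * x + t) @^-1` D).
  by rewrite -[X in measurable X]setTI; exact: mh.
have hDfin : (lebesgue_measure ((fun x => s * x + t)%R @^-1` D) < +oo)%E.
  move: Dfin; rewrite (lebesgue_measure_affine_preimage t s0 mD).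
  case: (lebesgue_measure _) => [r| |] //; first by move=> _; exact: ltry.
  by rewrite gt0_muley ?lte_fin.
have bgh : bounded_measurable setT (fun x => g (s * x + t)).
  exact: (bounded_measurable_comp measurableT mh).
have igh : lebesgue_measure.-integrable ((fun x => s * x + t) @^-1` D)
    (EFin \o (fun x => g (s * x + t))).
  apply: bounded_measurable_integrable => //.
  exact: (@bounded_measurableS _ _ setT).
have mg : measurable_fun setT (EFin \o g) by apply/measurable_EFinP; case: bg.
pose pf : {measure set (measurableTypeR R) -> \bar R} :=
  measure_function_pushforward__canonical__measure_function_Measure
    lebesgue_measure mh.
rewrite (@Rintegral_proportional lebesgue_measure pf D g `|s|) //=.
- rewrite mulrA mulVf ?gt_eqF// mul1r /Rintegral.
  by rewrite (integral_pushforward mh mg igh mD).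
- exact: integrable_pushforward.
- by move=> B mB _; exact: lebesgue_measure_affine_preimage.
Qed.

End ChangeOfMeasure.

(** * Partitions into cells *)

Section Cells.
Context (R : realType) (I : set (measurableTypeR R)) (N : nat).
Context (u v : 'I_N -> R).
Hypothesis part : is_partition I u v.

Local Notation cell_union := (\bigcup_(k in [set: 'I_N]) int_cell u v k).

Lemma int_cellE k : int_cell u v k = `]u k, v k[%classic.
Proof. by rewrite /int_cell /cell interior_itv. Qed.

Lemma measurable_int_cell k :
  measurable (int_cell u v k : set (measurableTypeR R)).
Proof. by rewrite int_cellE; exact: measurable_itv. Qed.

Lemma measurable_cell_union : measurable (cell_union : set (measurableTypeR R)).
Proof.
by apply: fin_bigcup_measurable => // k _; exact: measurable_int_cell.
Qed.

Lemma int_cell_subset k : int_cell u v k `<=` I.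
Proof.
have [_ _ <-] := part; move=> x xk; exists k => //.
by move: xk; rewrite int_cellE /cell; apply: subset_itv_oo_cc.
Qed.

Lemma int_cell_disjoint k l x :
  int_cell u v k x -> int_cell u v l x -> k = l.
Proof.
move=> xk xl; have [_ tI _] := part.
by apply: tI => //; exists x.
Qed.

Lemma lebesgue_int_cell k : lebesgue_measure (int_cell u v k) = (v k - u k)%:E.
Proof.
have [uv _ _] := part.
by rewrite int_cellE lebesgue_measure_itv/= lte_fin uv.
Qed.

Lemma lebesgue_int_cell_fin k : (lebesgue_measure (int_cell u v k) < +oo)%E.
Proof. by rewrite lebesgue_int_cell ltry. Qed.

(** The cells cover [I], and a closed interval exceeds its interior by its two
    endpoints only. *)
Lemma finite_cell_endpoints : finite_set (I `\` cell_union).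
Proof.
have [uv _ cI] := part.
apply: (@sub_finite_set _ _ (\bigcup_(k in [set: 'I_N]) [set u k; v k])).
  rewrite -cI => x [[k _ xk] nx]; exists k => //.
  have [->|xu] := eqVneq x (u k); first by left.
  have [->|xv] := eqVneq x (v k); first by right.
  exfalso; apply: nx; exists k => //; rewrite int_cellE.
  move: xk; rewrite /cell /= !in_itv/= => /andP[ux xv'].
  by rewrite !lt_neqAle ux xv' xv eq_sym xu.
by apply: bigcup_finite => // k _; exact: finite_set2.
Qed.

Lemma measurable_cell_endpoints :
  measurable (I `\` cell_union : set (measurableTypeR R)).
Proof.
exact/countable_measurable/finite_set_countable/finite_cell_endpoints.
Qed.

Lemma cell_unionE : I = cell_union `|` (I `\` cell_union).
Proof.
rewrite setDUK// => x [k _ xk]; exact: int_cell_subset xk.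
Qed.

Lemma lebesgue_cell_endpoints : lebesgue_measure (I `\` cell_union) = 0%E.
Proof.
exact/countable_lebesgue_measure0/finite_set_countable/finite_cell_endpoints.
Qed.

Lemma measurable_partition : measurable I.
Proof.
rewrite cell_unionE; apply: measurableU; first exact: measurable_cell_union.
exact: measurable_cell_endpoints.
Qed.

Lemma measurable_fun_finite (E : set (measurableTypeR R))
    (g : measurableTypeR R -> measurableTypeR R) :
  finite_set E -> measurable_fun E g.
Proof.
move=> fE mE Y mY; apply: countable_measurable.
  by move=> t; exact: measurable_set1.
by apply: finite_set_countable; apply: sub_finite_set fE; exact: subIsetl.
Qed.

Lemma measurable_fun_cells (g : measurableTypeR R -> measurableTypeR R) :
  (forall k, measurable_fun (int_cell u v k) g) -> measurable_fun I g.
Proof.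
move=> mg; rewrite cell_unionE; apply/measurable_funU.
- exact: measurable_cell_union.
- exact: measurable_cell_endpoints.
split; last exact: measurable_fun_finite finite_cell_endpoints.
move=> mU Y mY; rewrite setI_bigcupl; apply: fin_bigcup_measurable => // k _.
by apply: mg => //; exact: measurable_int_cell.
Qed.

(** The endpoints are finitely many, so every function is measurable on them;
    as they have measure zero, only the open cells contribute. *)
Lemma Rintegral_cells (m : {measure set (measurableTypeR R) -> \bar R}) g :
  m (I `\` cell_union) = 0%E ->
  (forall k, (m (int_cell u v k) < +oo)%E) ->
  (forall k, bounded_measurable (int_cell u v k) g) ->
  \int[m]_(x in I) g x = \sum_k \int[m]_(x in int_cell u v k) g x.
Proof.
move=> mE mfin bg.
have mg : measurable_fun I g by apply: measurable_fun_cells => k; case: (bg k).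
have ig k : m.-integrable (int_cell u v k) (EFin \o g).
  by apply: bounded_measurable_integrable => //; exact: measurable_int_cell.
rewrite /Rintegral sum_fine; last first.
  by move=> k _; exact: (integrable_fin_num (measurable_int_cell k) (ig k)).
congr fine; rewrite [in LHS]cell_unionE integral_setU//=; last 4 first.
- exact: measurable_cell_union.
- exact: measurable_cell_endpoints.
- by rewrite -cell_unionE; exact/measurable_EFinP.
- by apply/eqP; rewrite setDIK.
rewrite [X in (_ + X)%E]null_set_integral ?adde0//; last 2 first.
- exact: measurable_cell_endpoints.
- apply/measurable_EFinP; apply: measurable_funS mg => //.
  exact: measurable_partition.
have enumT : [set` index_enum 'I_N] = setT.
  by apply/seteqP; split => k //= _; rewrite mem_index_enum.
rewrite -enumT bigcup_seq integral_bigsetU_EFin//.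
- exact: measurable_int_cell.
- exact: index_enum_uniq.
- by have [_ tI _] := part; rewrite enumT.
- rewrite -bigcup_seq enumT; apply/measurable_EFinP.
  apply: measurable_funS mg; first exact: measurable_partition.
  by move=> x [k _]; exact: int_cell_subset.
Qed.

End Cells.

(** * The transfer formula *)

Section Transfer.
Context (R : realType) (I : set (measurableTypeR R)) (f : R -> R) (N : nat).
Context (u v gamma d : 'I_N -> R).
Hypothesis fI : forall x, I x -> I (f x).
Hypothesis boundedI : bounded_measurable I id.
Hypothesis markov : is_markov_partition I f u v.
Hypothesis intercept : is_intercept f u v gamma d.
Hypothesis gamma_neq0 : forall k, gamma k != 0.

Let part : is_partition I u v. Proof. by case: markov. Qed.

(** The transition relation of the Markov partition. *)
Definition covers (k l : 'I_N) : bool :=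
  `[< int_cell u v l `<=` f @` int_cell u v k >].

(** The inverse branch of [f] on cell [k], as a polynomial: composing with it
    keeps the degree, which is what makes polynomial weights tractable. *)
Definition branch_poly k : {poly R} := (gamma k)^-1 *: ('X - (d k)%:P).

Lemma branch_poly_affine k x : (branch_poly k).[gamma k * x + d k] = x.
Proof. by rewrite /branch_poly !hornerE addrK mulKf. Qed.

Lemma measurable_markov_map :
  measurable_fun I (f : measurableTypeR R -> measurableTypeR R).
Proof.
apply: (measurable_fun_cells part) => k.
apply: (@eq_measurable_fun _ _ _ _ _ (fun x => gamma k * x + d k)).
  by move=> x /set_mem xk; rewrite (intercept xk).
apply: measurable_funTS; exact: measurable_affine.
Qed.

Lemma bounded_measurable_orbit g n : bounded_measurable I g ->
  bounded_measurable I (fun x => g (iter n f x)).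
Proof.
move=> bg; elim: n => // n ih; under eq_fun do rewrite iterSr.
apply: (bounded_measurable_comp (measurable_partition part)
  measurable_markov_map fI ih).
Qed.

Lemma image_int_cell k :
  f @` int_cell u v k =
  (fun y => (gamma k)^-1 * y + - (d k / gamma k)) @^-1` int_cell u v k.
Proof.
apply/seteqP; split => [_ [x xk <-]|y /= yk].
  by rewrite /= (intercept xk) mulrDr mulKf// [_^-1 * d k]mulrC addrK.
eexists; first exact: yk.
by rewrite (intercept yk) mulrDr mulVKf// mulrN mulrCA mulfV// mulr1 subrK.
Qed.

Lemma preimage_image_int_cell k :
  (fun x => gamma k * x + d k) @^-1` (f @` int_cell u v k) = int_cell u v k.
Proof.
rewrite image_int_cell; apply/seteqP; split => x /=;
by rewrite mulrDr mulKf// [_^-1 * d k]mulrC addrK.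
Qed.

Lemma measurable_image_int_cell k :
  measurable (f @` int_cell u v k : set (measurableTypeR R)).
Proof.
rewrite image_int_cell -[X in measurable X]setTI; apply: measurable_affine => //.
exact: measurable_int_cell.
Qed.

Lemma image_int_cell_subset k : f @` int_cell u v k `<=` I.
Proof. by move=> _ [x xk <-]; apply: fI; exact: int_cell_subset xk. Qed.

(** By the Markov property the image of a cell contains or misses each open
    cell, hence is a union of cells up to finitely many points. *)
Lemma Rintegral_image_cells k g : bounded_measurable I g ->
  \int[lebesgue_measure]_(y in f @` int_cell u v k) g y =
  \sum_(l | covers k l) \int[lebesgue_measure]_(y in int_cell u v l) g y.
Proof.
move=> bg.
have mI := measurable_partition part.
have mJ := measurable_image_int_cell k.
rewrite -[f @` _](setIidr (@image_int_cell_subset k)) Rintegral_mkcondr.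
rewrite (Rintegral_cells part (lebesgue_cell_endpoints part)); last first.
- move=> l; apply: (bounded_measurableS mI (int_cell_subset part (k := l))).
  rewrite patch_indic; apply: bounded_measurableM => //.
  exact: bounded_measurable_indic.
- exact: lebesgue_int_cell_fin part.
rewrite [RHS]big_mkcond; apply: eq_bigr => l _.
case: ifPn => [/asboolP kl|/asboolP kl].
  by apply: eq_Rintegral => y /set_mem yl; rewrite patchE mem_set//; exact: kl.
have [_ /(_ k l) [disj|//]] := markov.
rewrite (@eq_Rintegral _ _ _ _ _ (fun=> 0)).
  by rewrite Rintegral_cst ?mul0r//; exact: measurable_int_cell.
move=> y /set_mem yl; rewrite patchE memNset// => yJ.
by have : set0 y by rewrite -disj.
Qed.

(** The transfer operator acting on polynomial weights: the affine change of
    variables [y = f x] on cell [k], followed by cutting the image into the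
    cells that it covers. *)
Lemma Rintegral_transfer k (p : {poly R}) g : bounded_measurable I g ->
  \int[lebesgue_measure]_(x in int_cell u v k) (p.[x] * g (f x)) =
  `|gamma k|^-1 * \sum_(l | covers k l)
    \int[lebesgue_measure]_(y in int_cell u v l)
      ((p \Po branch_poly k).[y] * g y).
Proof.
move=> bg; set q := p \Po _.
have mI := measurable_partition part.
have mJ := measurable_image_int_cell k.
have bqg : bounded_measurable I (fun y => q.[y] * g y).
  by apply: bounded_measurableM => //; exact: bounded_measurable_horner.
rewrite -Rintegral_image_cells//.
have patchI y : I y -> ((fun y => q.[y] * g y) \_ I) y = q.[y] * g y.
  by move=> yI; rewrite patchE mem_set.
rewrite [in RHS](@eq_Rintegral _ _ _ _ _ ((fun y => q.[y] * g y) \_ I)); last first.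
  by move=> y /set_mem /image_int_cell_subset /patchI.
rewrite -(@Rintegral_affine _ (gamma k) (d k))//; last 2 first.
- rewrite (lebesgue_measure_affine_preimage (d k) (gamma_neq0 k) mJ).
  by rewrite preimage_image_int_cell (lebesgue_int_cell part) -EFinM ltry.
- exact: bounded_measurable_patch.
rewrite preimage_image_int_cell; apply: eq_Rintegral => x /set_mem xk.
have fx := intercept xk.
rewrite patchI -?fx; last exact/fI/(int_cell_subset part xk).
by rewrite /q horner_comp fx branch_poly_affine.
Qed.

End Transfer.

(** * Dual weights *)

Section DualWeights.
Context (R : realType) (N : nat) (u v : 'I_N -> R).

(** On each cell, integration against [g] reads off the [j]-th coefficient of a
    polynomial of degree at most [j], up to the factor [m k]. Such a [g] is
    orthogonal to all lower degrees, and this property survives composition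
    with a piecewise linear Markov map; only the vector [m] changes. *)
Definition dual_weight (j : nat) (g : R -> R) (m : 'I_N -> R) : Prop :=
  forall k (p : {poly R}), (size p <= j.+1)%N ->
    \int[lebesgue_measure]_(x in int_cell u v k) (p.[x] * g x) = p`_j * m k.

(** Stated up to any bound [n] on the size, so that explicit coefficient lists
    with possibly vanishing last entries can be used. *)
Lemma Rintegral_horner (a b : R) (p : {poly R}) n : a < b -> (size p <= n)%N ->
  \int[lebesgue_measure]_(x in `]a, b[) p.[x] =
  \sum_(i < n) p`_i * (b ^+ i.+1 - a ^+ i.+1) / i.+1%:R.
Proof.
move=> ab pn; pose P : {poly R} := \sum_(i < n) (p`_i / i.+1%:R) *: 'X^(i.+1).
have dP : P^`() = p.
  rewrite /P raddf_sum/= [RHS](_ : _ = \poly_(i < n) p`_i); last first.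
    apply/polyP => i; rewrite coef_poly; case: ltnP => // ni.
    by rewrite nth_default// (leq_trans pn).
  rewrite poly_def; apply: eq_bigr => i _.
  by rewrite derivZ derivXn/= -scalerMnr scalerMnl -mulr_natr divfK// pnatr_eq0.
have ip : lebesgue_measure.-integrable `[a, b] (EFin \o horner p).
  apply: bounded_measurable_integrable; first exact: measurable_itv.
    by rewrite /= lebesgue_measure_itv/= lte_fin ab -EFinB ltry.
  exact: bounded_measurable_horner (bounded_measurable_id a b).
rewrite Rintegral_itv_obnd_cbnd; last first.
  by apply: integrableS ip => //; exact: subset_itv_oo_cc.
rewrite Rintegral_itv_bndo_bndc; last first.
  by apply: integrableS ip => //; exact: subset_itv_co_cc.
rewrite /Rintegral (continuous_FTC2 (F := horner P) ab).
- rewrite -EFinB/= /P !horner_sum -sumrB; apply: eq_bigr => i _.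
  by rewrite !hornerE -mulrBr mulrAC.
- by apply: continuous_subspaceT => x; exact: continuous_horner.
- split; first by move=> x _; exact: derivable_horner.
    by apply: cvg_at_right_filter; exact: continuous_horner.
  by apply: cvg_at_left_filter; exact: continuous_horner.
- by move=> x _; rewrite -derivE dP.
Qed.

End DualWeights.

(** * Exponential averages along a stationary Markov chain *)

Section BirkhoffSums.
Context (R : realType) (T : finType).
Context (P : T -> T -> R) (pi c : T -> R).
Hypothesis P_ge0 : forall k l, 0 <= P k l.
Hypothesis P_sum1 : forall k, \sum_l P k l = 1.
Hypothesis pi_ge0 : forall k, 0 <= pi k.
Hypothesis pi_sum1 : \sum_k pi k = 1.
Hypothesis pi_stationary : forall l, \sum_k pi k * P k l = pi l.

(** The expectation of exp(-(c k0 + ... + c k(n-1))) for the Markov chain with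
    transition matrix [P] started at [k = k0]. *)
Fixpoint discounted (n : nat) (k : T) : R :=
  if n is n'.+1 then expR (- c k) * \sum_l P k l * discounted n' l else 1.

(** The expectation of the exponent itself, c k0 + ... + c k(n-1). *)
Fixpoint expected_cost (n : nat) (k : T) : R :=
  if n is n'.+1 then c k + \sum_l P k l * expected_cost n' l else 0.

(** Sum the tangent line inequality exp x >= exp m (1 + (x - m)) at the mean
    [m]: the linear term averages to zero. *)
Lemma jensen_expR (p x : T -> R) : (forall k, 0 <= p k) -> \sum_k p k = 1 ->
  expR (\sum_k p k * x k) <= \sum_k p k * expR (x k).
Proof.
move=> p0 p1; set m := \sum_k p k * x k.
have -> : expR m = \sum_k p k * (expR m * (1 + (x k - m))).
  transitivity (expR m * (\sum_k p k * (1 - m) + \sum_k p k * x k)).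
    by rewrite -mulr_suml p1 mul1r subrK mulr1.
  rewrite -big_split mulr_sumr; apply: eq_bigr => k _ /=.
  by rewrite -mulrDr mulrCA; congr (_ * (_ * _)); rewrite addrAC addrA.
apply: ler_sum => k _; apply: ler_wpM2l => //.
have -> : expR (x k) = expR m * expR (x k - m) by rewrite -expRD addrC subrK.
by rewrite ler_wpM2l ?expR_ge0// expR_ge1Dx.
Qed.

Lemma expected_cost_stationary n :
  \sum_k pi k * expected_cost n k = n%:R * \sum_k pi k * c k.
Proof.
elim: n => [|n ih] /=.
  by rewrite mul0r big1// => k _; rewrite mulr0.
under eq_bigr do rewrite mulrDr.
rewrite big_split/= -natr1 mulrDl mul1r addrC -ih; congr (_ + _).
under eq_bigr do rewrite mulr_sumr.
rewrite exchange_big/=; apply: eq_bigr => l _.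
rewrite -[in RHS](pi_stationary l) mulr_suml.
by apply: eq_bigr => k _; rewrite mulrA.
Qed.

(** Jensen's inequality once per step of the chain. *)
Lemma discounted_ge n k : expR (- expected_cost n k) <= discounted n k.
Proof.
elim: n k => [|n ih] k /=; first by rewrite oppr0 expR0.
rewrite opprD expRD ler_wpM2l ?expR_ge0//.
have -> : - (\sum_l P k l * expected_cost n l) =
          \sum_l P k l * - expected_cost n l.
  by rewrite -sumrN; apply: eq_bigr => l _; rewrite mulrN.
apply: le_trans (jensen_expR _ (P_ge0 k) (P_sum1 k)) _.
by apply: ler_sum => l _; rewrite ler_wpM2l.
Qed.

Lemma discounted_stationary_ge n :
  expR (- (n%:R * \sum_k pi k * c k)) <= \sum_k pi k * discounted n k.
Proof.
have -> : - (n%:R * \sum_k pi k * c k) = \sum_k pi k * - expected_cost n k.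
  rewrite -expected_cost_stationary -sumrN.
  by apply: eq_bigr => k _; rewrite mulrN.
apply: le_trans (jensen_expR _ pi_ge0 pi_sum1) _.
by apply: ler_sum => k _; rewrite ler_wpM2l// discounted_ge.
Qed.

End BirkhoffSums.

(** * Legendre polynomials and renormalization *)

Section DualPolynomials.
Context (R : realType).

(** Multiples of the Legendre polynomials of degrees 1 and 2 of the interval
    [a, b]; the factors 12 and 180 make the [j]-th coefficient come out
    multiplied by exactly the length of the interval. *)
Definition dual_poly1 (a b : R) : {poly R} :=
  (12 / (b - a) ^+ 2) *: ('X - ((a + b) / 2)%:P).

Definition dual_poly2 (a b : R) : {poly R} :=
  (180 / (b - a) ^+ 4) *:
    (('X - ((a + b) / 2)%:P) ^+ 2 - ((b - a) ^+ 2 / 12)%:P).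

Lemma Rintegral_dual_poly1 (a b : R) (p : {poly R}) : a < b ->
  (size p <= 2)%N ->
  \int[lebesgue_measure]_(x in `]a, b[) (p.[x] * (dual_poly1 a b).[x]) =
  p`_1 * (b - a).
Proof.
move=> ab p2.
have ba : b - a != 0 by rewrite subr_eq0 gt_eqF.
pose A := 12 / (b - a) ^+ 2; pose m := (a + b) / 2.
pose q := Poly [:: - A * m * p`_0; A * p`_0 - A * m * p`_1; A * p`_1].
rewrite (@eq_Rintegral _ _ _ _ _ (horner q : measurableTypeR R -> R)); last first.
  move=> x _; rewrite (horner_coef_wide x p2) horner_Poly/= /dual_poly1.
  by rewrite !big_ord_recr big_ord0/= hornerZ hornerXsubC -/A -/m; ring.
rewrite (@Rintegral_horner _ _ _ _ 3) ?size_Poly//.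
rewrite !big_ord_recr big_ord0/= !coef_Poly/= /A /m.
by field.
Qed.

Lemma Rintegral_dual_poly2 (a b : R) (p : {poly R}) : a < b ->
  (size p <= 3)%N ->
  \int[lebesgue_measure]_(x in `]a, b[) (p.[x] * (dual_poly2 a b).[x]) =
  p`_2 * (b - a).
Proof.
move=> ab p3.
have ba : b - a != 0 by rewrite subr_eq0 gt_eqF.
pose A := 180 / (b - a) ^+ 4; pose m := (a + b) / 2.
pose e := m ^+ 2 - (b - a) ^+ 2 / 12.
pose q := Poly [:: A * e * p`_0; A * (e * p`_1 - 2 * m * p`_0);
  A * (e * p`_2 - 2 * m * p`_1 + p`_0); A * (p`_1 - 2 * m * p`_2); A * p`_2].
rewrite (@eq_Rintegral _ _ _ _ _ (horner q : measurableTypeR R -> R)); last first.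
  move=> x _; rewrite (horner_coef_wide x p3) horner_Poly/= /dual_poly2.
  rewrite !big_ord_recr big_ord0/= hornerZ hornerD hornerN hornerC horner_exp.
  by rewrite hornerXsubC -/A -/m /e; ring.
rewrite (@Rintegral_horner _ _ _ _ 5) ?size_Poly//.
rewrite !big_ord_recr big_ord0/= !coef_Poly/= /e /A /m.
by field.
Qed.

End DualPolynomials.

Section Renormalization.
Context (R : realType) (I : set (measurableTypeR R)) (f : R -> R) (N : nat).
Context (u v gamma d : 'I_N -> R).
Hypothesis fI : forall x, I x -> I (f x).
Hypothesis boundedI : bounded_measurable I id.
Hypothesis markov : is_markov_partition I f u v.
Hypothesis intercept : is_intercept f u v gamma d.
Hypothesis gamma_neq0 : forall k, gamma k != 0.

(** The transfer operator is triangular on polynomials filtered by degree, and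
    this is (the transpose of) its diagonal block in degree [j]. *)
Definition renormalize (j : nat) (m : 'I_N -> R) (k : 'I_N) : R :=
  `|gamma k|^-1 * (gamma k)^-1 ^+ j * \sum_(l | covers f u v k l) m l.

Lemma size_comp_branch_poly k (p : {poly R}) :
  size (p \Po branch_poly gamma d k) = size p.
Proof.
rewrite size_comp_poly2// /branch_poly size_scale ?invr_eq0//.
by rewrite size_XsubC.
Qed.

(** Only the top coefficient matters, and it is multiplied by the [j]-th power
    of the slope of the inverse branch. *)
Lemma coef_comp_branch_poly k j (p : {poly R}) : (size p <= j.+1)%N ->
  (p \Po branch_poly gamma d k)`_j = p`_j * (gamma k)^-1 ^+ j.
Proof.
rewrite leq_eqVlt => /predU1P[pj|]; last first.
  by rewrite ltnS => pj; rewrite !nth_default ?mul0r// size_comp_branch_poly.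
have sb : size (branch_poly gamma d k) = 2%N.
  by rewrite /branch_poly size_scale ?invr_eq0// size_XsubC.
have := @lead_coef_comp _ p (branch_poly gamma d k).
rewrite sb !lead_coefE size_comp_branch_poly pj sb/= => ->//.
by rewrite /branch_poly coefZ coefB coefX coefC/= subr0 mulr1.
Qed.

Lemma dual_weight_comp j g m : bounded_measurable I g ->
  dual_weight u v j g m ->
  dual_weight u v j (fun x => g (f x)) (renormalize j m).
Proof.
move=> bg gm k p pj; rewrite (Rintegral_transfer fI boundedI markov intercept)//.
under eq_bigr do rewrite gm ?size_comp_branch_poly// coef_comp_branch_poly//.
by rewrite -mulr_sumr /renormalize; ring.
Qed.

Lemma dual_weight_iter j g m n : bounded_measurable I g ->
  dual_weight u v j g m ->
  dual_weight u v j (fun x => g (iter n f x)) (iter n (renormalize j) m).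
Proof.
move=> bg gm; elim: n => [//|n ih]; rewrite [iter n.+1 (renormalize j) m]iterS.
under eq_fun do rewrite iterSr.
apply: (dual_weight_comp _ ih).
exact: (bounded_measurable_orbit fI markov intercept).
Qed.

(** [f] stretches cell [k] by its slope and maps it onto the cells that it
    covers; this is the transfer formula for the weight 1. It says that the
    transition probabilities of the chain used below sum to 1. *)
Lemma cell_lengths_covered k :
  \sum_(l | covers f u v k l) (v l - u l) = `|gamma k| * (v k - u k).
Proof.
have part : is_partition I u v by case: markov.
have len l : \int[lebesgue_measure]_(y in int_cell u v l) 1 = v l - u l.
  rewrite Rintegral_cst; last exact: measurable_int_cell.
  by rewrite mul1r [X in fine X](lebesgue_int_cell part).
have := Rintegral_transfer fI boundedI markov intercept gamma_neq0 k 1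
  (bounded_measurable_cst I 1).
rewrite (@eq_Rintegral _ _ _ _ _ (fun=> 1)); last first.
  by move=> x _; rewrite hornerC mulr1.
rewrite len => ->; rewrite mulVKf ?normr_eq0//; apply: eq_bigr => l _.
rewrite -len; apply: eq_Rintegral => y _.
by rewrite comp_polyC hornerC mulr1.
Qed.

End Renormalization.

(** * Invariant density and correlations *)

Section Density.
Context (R : realType) (I : set (measurableTypeR R)) (N : nat).
Context (u v : 'I_N -> R) (mu : probability (measurableTypeR R) R).
Hypothesis part : is_partition I u v.
Hypothesis density : has_piecewise_constant_density I u v mu.

(** The density relative to Lebesgue measure, read as one constant per cell. *)
Definition is_cell_density (w : 'I_N -> R) : Prop :=
  (forall k, 0 <= w k) /\
  forall k (B : set (measurableTypeR R)), measurable B ->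
    B `<=` int_cell u v k -> mu B = ((w k)%:E * lebesgue_measure B)%E.

Lemma cell_density_exists : exists w, is_cell_density w.
Proof.
have [uv _ _] := part.
have [rho [mrho rho0 rhoc muE]] := density.
have [w wE] := choice rhoc.
exists w; split=> k.
  have mid : int_cell u v k ((u k + v k) / 2).
    by rewrite int_cellE /= in_itv/=; have := uv k; lra.
  by rewrite -(wE k _ mid) rho0//; exact: (int_cell_subset part mid).
move=> B mB Bk.
rewrite muE//; last exact: subset_trans Bk (int_cell_subset part (k := k)).
rewrite (eq_integral (fun=> (w k)%:E)) ?integral_cst//.
by move=> x /set_mem /Bk /wE ->.
Qed.

Lemma cell_endpoints_negligible :
  mu (I `\` \bigcup_(k in [set: 'I_N]) int_cell u v k) = 0%E.
Proof.
have [rho [_ _ _ muE]] := density.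
have mE := measurable_cell_endpoints part.
rewrite muE//; apply: null_set_integral => //.
  apply/measurable_EFinP.
  exact: (@measurable_fun_finite _ _ _ (finite_cell_endpoints part)).
exact: lebesgue_cell_endpoints part.
Qed.

Lemma Rintegral_density w g : is_cell_density w ->
  (forall k, bounded_measurable (int_cell u v k) g) ->
  \int[mu]_(x in I) g x =
  \sum_k w k * \int[lebesgue_measure]_(x in int_cell u v k) g x.
Proof.
move=> [w0 wE] bg; rewrite (Rintegral_cells part cell_endpoints_negligible)//.
  apply: eq_bigr => k _; apply: Rintegral_proportional => //.
  - exact: measurable_int_cell.
  - apply: bounded_measurable_integrable => //.
      exact: measurable_int_cell.
    exact: (lebesgue_int_cell_fin part).
  - exact: wE.
move=> k; apply: le_lt_trans (probability_le1 mu (measurable_int_cell u v k)) _.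
exact: ltry.
Qed.

Lemma cell_density_total w : is_cell_density w -> mu I = 1%E ->
  \sum_k w k * (v k - u k) = 1.
Proof.
move=> dw muI.
have := Rintegral_density dw (fun k => bounded_measurable_cst (int_cell u v k) 1).
rewrite Rintegral_cst; last exact: measurable_partition part.
rewrite mul1r [X in fine X]muI/= => tot; rewrite [RHS]tot; apply: eq_bigr => k _.
rewrite Rintegral_cst; last exact: measurable_int_cell.
by rewrite mul1r [X in fine X](lebesgue_int_cell part).
Qed.

End Density.

Section Correlations.
Context (R : realType) (I : set (measurableTypeR R)) (f : R -> R) (N : nat).
Context (u v gamma d : 'I_N -> R) (mu : probability (measurableTypeR R) R).
Context (w : 'I_N -> R).
Hypothesis fI : forall x, I x -> I (f x).
Hypothesis boundedI : bounded_measurable I id.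
Hypothesis markov : is_markov_partition I f u v.
Hypothesis slopes : piecewise_linear f u v gamma.
Hypothesis intercept : is_intercept f u v gamma d.
Hypothesis gamma_neq0 : forall k, gamma k != 0.
Hypothesis muI : mu I = 1%E.
Hypothesis density : has_piecewise_constant_density I u v mu.
Hypothesis dw : is_cell_density u v mu w.
Hypothesis invariant : invariant_on I f mu.

Let part : is_partition I u v. Proof. by case: markov. Qed.

Lemma lyapunovE :
  lyapunov mu I f = \sum_k w k * (v k - u k) * ln `|gamma k|.
Proof.
have lnE k : {in int_cell u v k,
    (fun x => ln `|f^`()%classic x|) =1 (fun=> ln `|gamma k|)}.
  by move=> x /set_mem xk; have [_ ->] := slopes xk.
rewrite /lyapunov (Rintegral_density part density dw); last first.
  move=> k; split; last first.
    by exists `|ln `|gamma k| | => x xk; rewrite (lnE k x) ?mem_set.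
  apply: eq_measurable_fun (measurable_cst (ln `|gamma k|)) => x xk.
  by rewrite (lnE k x xk).
apply: eq_bigr => k _; rewrite (@eq_Rintegral _ _ _ _ _ (fun=> ln `|gamma k|)).
  rewrite Rintegral_cst; last exact: measurable_int_cell.
  by rewrite [X in fine X](lebesgue_int_cell part)/= -mulrA [ln _ * _]mulrC.
exact: lnE.
Qed.

(** The Perron-Frobenius equation of an invariant density: test invariance on
    the cell [l], and compute the measure of its preimage cell by cell. *)
Lemma cell_density_invariant l :
  \sum_k w k / `|gamma k| * (covers f u v k l)%:R = w l.
Proof.
have [uv _ _] := part.
have mI := measurable_partition part.
have ml := measurable_int_cell u v l.
have bl : bounded_measurable I (\1_(int_cell u v l) : R -> R).
  exact: bounded_measurable_indic.
have overlap k : \int[lebesgue_measure]_(y in int_cell u v k)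
    \1_(int_cell u v l) y = (l == k)%:R * (v l - u l).
  have [<-|lk] := eqVneq l k.
    rewrite (@eq_Rintegral _ _ _ _ _ (fun=> 1)).
      by rewrite Rintegral_cst// [X in _ * fine X](lebesgue_int_cell part).
    by move=> x xl; rewrite indicE xl.
  rewrite mul0r (@eq_Rintegral _ _ _ _ _ (fun=> 0)).
    by rewrite Rintegral_cst ?mul0r//; exact: measurable_int_cell.
  move=> x /set_mem xk; rewrite indicE memNset// => xl.
  by case/eqP: lk; exact: (int_cell_disjoint part xl xk).
have bfl := bounded_measurable_orbit fI markov intercept 1 bl.
have mpre : measurable (I `&` f @^-1` int_cell u v l).
  exact: (measurable_markov_map markov intercept).
have inv : \int[mu]_(x in I) \1_(int_cell u v l) (f x) = w l * (v l - u l).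
  rewrite (@eq_Rintegral _ _ _ _ _ (\1_(I `&` f @^-1` int_cell u v l))).
    rewrite /Rintegral integral_indic// setIAC setIid.
    have [_ wE] := dw.
    rewrite [X in fine X](invariant ml (int_cell_subset part (k := l))).
    rewrite (wE l _ ml (@subset_refl _ _)).
    by rewrite [X in (_ * X)%E](lebesgue_int_cell part).
  move=> x xI; rewrite !indicE in_setI xI.
  by congr (nat_of_bool _)%:R; apply/idP/idP => /set_mem ?; exact/mem_set.
have vul : v l - u l != 0 by rewrite subr_eq0 gt_eqF.
apply: (mulIf vul); rewrite -inv mulr_suml (Rintegral_density part density dw).
  apply: eq_bigr => k _.
  have := Rintegral_transfer fI boundedI markov intercept gamma_neq0 k 1 bl.
  rewrite [X in X = _ -> _](@eq_Rintegral _ _ _ _ _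
    (fun x : measurableTypeR R => \1_(int_cell u v l) (f x))); last first.
    by move=> x _; rewrite hornerC mul1r.
  move=> ->; rewrite -!mulrA; congr (_ * (_ * _)).
  rewrite big_mkcond (bigD1 l)//= big1 ?addr0 => [|l' ll'].
    case: ifP => _; last by rewrite mul0r.
    transitivity (\int[lebesgue_measure]_(y in int_cell u v l)
      \1_(int_cell u v l) y); first by rewrite overlap eqxx.
    by apply: eq_Rintegral => y _; rewrite comp_polyC hornerC mul1r.
  case: ifP => // _.
  transitivity (\int[lebesgue_measure]_(y in int_cell u v l')
    \1_(int_cell u v l) y).
    by apply: eq_Rintegral => y _; rewrite comp_polyC hornerC mul1r.
  by rewrite overlap eq_sym (negbTE ll') mul0r.
move=> k; exact: (bounded_measurableS mI (int_cell_subset part (k := k)) bfl).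
Qed.

(** With [psi] of degree [j] and [phi] dual to degree [j], the integral is
    the sum over [k] of [w k] times the renormalized lengths. Writing
    gamma^j = s |gamma|^j, it becomes s^-n times the average of
    exp(- j ln |(f^n)'|), an expectation for the stationary Markov chain of cell
    itineraries, to which Jensen's inequality applies; by stationarity the mean
    of the exponent is - n j Lambda. *)
Lemma correlation_lower_bound j (s : R) (phi psi : R -> R) n :
  `|s| = 1 -> (forall k, gamma k ^+ j = s * `|gamma k| ^+ j) ->
  bounded_measurable I phi ->
  dual_weight u v j phi (fun k => v k - u k) ->
  (forall k x, int_cell u v k x -> psi x = x ^+ j) ->
  expR (- (n%:R * (j%:R * lyapunov mu I f))) <=
  `|\int[mu]_(x in I) (phi (iter n f x) * psi x)|.
Proof.
move=> s1 gammas bphi dual_phi psiE.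
have [uv _ _] := part.
have mI := measurable_partition part.
have [w0 _] := dw.
have s0 : s != 0 by rewrite -normr_eq0 s1 oner_eq0.
pose len k : R := v k - u k; pose t k : R := `|gamma k|.
have len_gt0 k : 0 < len k by rewrite subr_gt0.
have t_gt0 k : 0 < t k by rewrite normr_gt0.
have len_neq0 k : len k != 0 by rewrite gt_eqF.
have t_neq0 k : t k != 0 by rewrite gt_eqF.
(* The conditional probability, under [mu], that the next cell is [l]. *)
pose P k l : R := (covers f u v k l)%:R * len l / (t k * len k).
(* The [mu]-measure of the cell [k], a stationary distribution for [P]. *)
pose pi k : R := w k * len k.
pose c k : R := j%:R * ln (t k).
have P_ge0 k l : 0 <= P k l.
  by rewrite /P !mulr_ge0 ?invr_ge0 ?mulr_ge0 ?ler0n// ltW.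
have P_sum1 k : \sum_l P k l = 1.
  rewrite -mulr_suml; apply: canLR (mulfK _) _; first by rewrite mulf_neq0.
  rewrite mul1r -(cell_lengths_covered fI boundedI markov intercept)//.
  by rewrite [RHS]big_mkcond; apply: eq_bigr => l _; case: ifP;
    rewrite ?mul1r ?mul0r.
have pi_ge0 k : 0 <= pi k by rewrite mulr_ge0// ltW.
have pi_sum1 : \sum_k pi k = 1 := cell_density_total part density dw muI.
have pi_stationary l : \sum_k pi k * P k l = pi l.
  rewrite /pi -(cell_density_invariant l) mulr_suml; apply: eq_bigr => k _.
  by rewrite /P -/(t k); field; rewrite len_neq0 t_neq0.
have massE k : iter n (renormalize f u v gamma j) len k =
               s^-1 ^+ n * (len k * discounted P c n k).
  elim: n k => [|n' ih] k; first by rewrite /= expr0 mul1r mulr1.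
  rewrite iterS /renormalize; under eq_bigr do rewrite ih.
  have -> : (gamma k)^-1 ^+ j = s^-1 * expR (- c k).
    rewrite exprVn gammas invfM; congr (_ * _).
    by rewrite /c expRN expRM_natl lnK ?posrE.
  rewrite -mulr_sumr big_mkcond /= exprS.
  rewrite (_ : \sum_l _ = t k * len k * \sum_l P k l * discounted P c n' l).
    by rewrite -/(t k); field; rewrite s0 t_neq0.
  rewrite mulr_sumr; apply: eq_bigr => l _; rewrite [P k l]/P.
  by case: ifP => _ /=; field; rewrite len_neq0 t_neq0.
have -> : \int[mu]_(x in I) (phi (iter n f x) * psi x) =
          s^-1 ^+ n * \sum_k pi k * discounted P c n k.
  rewrite (Rintegral_density part density dw) => [|k]; last first.
    apply: bounded_measurableM.
      apply: (bounded_measurableS mI (int_cell_subset part (k := k))).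
      exact: (bounded_measurable_orbit fI markov intercept).
    apply: (@bounded_measurable_eq _ _ (horner 'X^j)).
      by move=> x xk; rewrite hornerXn (psiE k).
    apply: (bounded_measurableS mI (int_cell_subset part (k := k))).
    exact: bounded_measurable_horner.
  rewrite mulr_sumr; apply: eq_bigr => k _.
  have sXj : (size ('X^j : {poly R}) <= j.+1)%N by rewrite size_polyXn.
  have := dual_weight_iter fI boundedI markov intercept gamma_neq0 n bphi
    dual_phi k sXj.
  rewrite coefXn eqxx mul1r massE => mass.
  rewrite (_ : s^-1 ^+ n * (pi k * discounted P c n k) =
      w k * (s^-1 ^+ n * (len k * discounted P c n k))).
    rewrite -mass; congr (_ * _).
    by apply: eq_Rintegral => x /set_mem /psiE ->; rewrite hornerXn mulrC.
  by rewrite /pi; ring.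
rewrite normrM normrX normfV s1 invr1 expr1n mul1r.
apply: le_trans (ler_norm _).
rewrite lyapunovE mulr_sumr.
rewrite (eq_bigr (fun k => pi k * c k)) => [|k _]; last by rewrite /pi mulrCA.
exact: discounted_stationary_ge.
Qed.

End Correlations.

(** * Polynomial observables and decay rates *)

Lemma derivable_horner_numField (K : numFieldType) (p : {poly K}) (z : K^o) :
  derivable (horner p : K^o -> K^o) z 1.
Proof.
elim/poly_ind: p => [|p e ih].
  rewrite (_ : horner 0 = cst 0); first exact: derivable_cst.
  by apply/funext => y; rewrite horner0.
rewrite (_ : horner _ =
    ((horner p : K^o -> K^o) * (id : K^o -> K^o) + (cst e : K^o -> K^o))).
  apply: derivableD; last exact: derivable_cst.
  by apply: derivableM => //; exact: derivable_id.
by apply/funext => y; rewrite hornerMXaddC.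
Qed.

Section ComplexPolynomials.
Context (R : realType).
Implicit Types (z c : R[i]) (p : {poly R[i]}).

Lemma complex_norm_ge0 z : exists2 x : R, 0 <= x & `|z| = x%:C.
Proof.
exists (Num.sqrt (complex.Re z ^+ 2 + complex.Im z ^+ 2)); last exact: normc_def.
exact: sqrtr_ge0.
Qed.

Lemma bounded_complex_horner p c (r : R) : exists M : R,
  forall z, ball (c : R[i]^o) r%:C z -> `|p.[z]| <= M%:C.
Proof.
have [n n0 cn] := complex_norm_ge0 c.
have zle z : ball (c : R[i]^o) r%:C z -> `|z| <= (n + r)%:C.
  rewrite -ball_normE /= => cz; rewrite rmorphD/= -cn.
  rewrite -[z](subrKC c) (le_trans (ler_normD _ _))// lerD2l distrC; exact: ltW.
elim/poly_ind: p => [|p e [M pM]].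
  by exists 0 => z _; rewrite horner0 normr0.
have [m m0 em] := complex_norm_ge0 e.
exists (M * (n + r) + m) => z cz; rewrite hornerMXaddC.
rewrite (le_trans (ler_normD _ _))// rmorphD rmorphM/= -em lerD2r normrM.
by rewrite ler_pM// ?pM ?zle.
Qed.

(** Polynomials are bounded on every disk, hence admissible observables. *)
Lemma Hinfty_horner p c (r : R) : Hinfty (ball (c : R[i]^o) r%:C) (horner p).
Proof.
split; first by move=> z _; exact: derivable_horner_numField.
exact: bounded_complex_horner.
Qed.

End ComplexPolynomials.

Section RealObservables.
Context (R : realType) (N : nat) (u v : 'I_N -> R).

Definition piecewise_poly (Q : 'I_N -> {poly R}) (x : R) : R :=
  \sum_(k < N | x \in int_cell u v k) (Q k).[x].

Lemma piecewise_poly_observable Q c (r : R) :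
  analytic_observables u v (ball (c : R[i]^o) r%:C)
    (fun x => (piecewise_poly Q x)%:C).
Proof.
exists (fun k => horner (map_poly (real_complex R) (Q k))).
  by move=> k; exact: Hinfty_horner.
apply/funext => x; rewrite /piecewise /piecewise_poly rmorph_sum/=.
by apply: eq_bigr => k _; rewrite horner_map.
Qed.

Lemma piecewise_polyE (I : set R) Q k x : is_partition I u v ->
  int_cell u v k x -> piecewise_poly Q x = (Q k).[x].
Proof.
move=> part xk; rewrite /piecewise_poly (bigD1 k) ?mem_set//= big1 ?addr0// => l.
case/andP=> /set_mem xl; case/eqP.
exact: (int_cell_disjoint part xl xk).
Qed.

Lemma bounded_measurable_piecewise_poly (I : set R) Q :
  is_partition I u v -> bounded_measurable I id ->
  bounded_measurable I (piecewise_poly Q).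
Proof.
move=> part bI.
apply: (@bounded_measurable_eq _ _
    (fun x => \sum_k \1_(int_cell u v k) x * (Q k).[x])).
  move=> x _; rewrite /piecewise_poly [RHS]big_mkcond; apply: eq_bigr => k _.
  by rewrite indicE; case: ifP; rewrite ?mul1r ?mul0r.
apply: bounded_measurable_sum => k; apply: bounded_measurableM.
  by apply: bounded_measurable_indic; exact: measurable_int_cell.
exact: bounded_measurable_horner.
Qed.

Lemma dual_weight1 (I : set R) : is_partition I u v ->
  dual_weight u v 1 (piecewise_poly (fun k => dual_poly1 (u k) (v k)))
    (fun k => v k - u k).
Proof.
move=> part; have [uv _ _] := part; move=> k p p2.
rewrite -Rintegral_dual_poly1// -int_cellE.
by apply: eq_Rintegral => x /set_mem xk; rewrite (piecewise_polyE _ part xk).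
Qed.

Lemma dual_weight2 (I : set R) : is_partition I u v ->
  dual_weight u v 2 (piecewise_poly (fun k => dual_poly2 (u k) (v k)))
    (fun k => v k - u k).
Proof.
move=> part; have [uv _ _] := part; move=> k p p3.
rewrite -Rintegral_dual_poly2// -int_cellE.
by apply: eq_Rintegral => x /set_mem xk; rewrite (piecewise_polyE _ part xk).
Qed.

End RealObservables.

Section DecayRate.
Context (R : realType) (mu : {measure set (measurableTypeR R) -> \bar R}).
Context (I : set R) (f : R -> R).

Lemma Cintegral_real (g : R -> R) :
  Cintegral mu I (fun x => (g x)%:C) = (\int[mu]_(x in I) g x)%:C.
Proof.
rewrite /Cintegral /= /Rintegral; congr (_ +i* _).
by rewrite integral0.
Qed.

Lemma correlation_real (phi psi : R -> R) n :
  correlation mu I f (fun x => (phi x)%:C) (fun x => (psi x)%:C) n =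
  (\int[mu]_(x in I) (phi (iter n f x) * psi x) -
   \int[mu]_(x in I) phi x * \int[mu]_(x in I) psi x)%:C.
Proof.
rewrite /correlation !Cintegral_real rmorphB rmorphM/=; congr (_ - _).
rewrite -Cintegral_real; congr (Cintegral _ _ _).
by apply/funext => x; rewrite rmorphM.
Qed.

(** If [s > r] then exp(s n) |C n| dominates 1 + n (s - r), so its upper limit
    is infinite and [s] does not belong to the set whose supremum is the decay
    rate. *)
Lemma decay_rate_le (phi psi : R -> R[i]) (C : nat -> R) (r : R) :
  (forall n, correlation mu I f phi psi n = (C n)%:C) ->
  (forall n, expR (- (n%:R * r)) <= `|C n|) ->
  (decay_rate mu I f phi psi <= r%:E)%E.
Proof.
move=> corE Cge; apply: ge_ereal_sup => _ [s /= sfin <-].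
rewrite lee_fin leNgt; apply/negP => rs.
move: sfin; apply/negP; rewrite -leNgt.
pose U n := complex.Re `|(expR (s * n%:R))%:C * correlation mu I f phi psi n|.
have Uge n : 1 + n%:R * (s - r) <= U n.
  rewrite /U corE -rmorphM normc_def/= expr0n addr0 sqrtr_sqr normrM.
  rewrite gtr0_norm ?expR_gt0//.
  apply: le_trans (ler_wpM2l (expR_ge0 _) (Cge n)).
  rewrite -expRD; apply: le_trans (expR_ge1Dx _) _.
  by rewrite ler_expR; lra.
have Uoo : (U n)%:E @[n --> \oo] --> +oo%E.
  apply/cvgeryP/cvgryPge => A.
  near=> n; apply: le_trans (Uge n).
  have sr : 0 < s - r by rewrite subr_gt0.
  rewrite -lerBlDl -ler_pdivrMr//.
  by near: n; exact: nbhs_infty_ger.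
have [_ ->] := cvg_limn_einf_sup Uoo.
exact: lexx.
Unshelve. all: by end_near.
Qed.

End DecayRate.

(** * The mixing rate *)

Section MixingRate.
Context (R : realType) (I : set (measurableTypeR R)) (f : R -> R) (N : nat).
Context (u v gamma d : 'I_N -> R) (mu : probability (measurableTypeR R) R).
Hypothesis fI : forall x, I x -> I (f x).
Hypothesis boundedI : bounded_measurable I id.
Hypothesis markov : is_markov_partition I f u v.
Hypothesis slopes : piecewise_linear f u v gamma.
Hypothesis intercept : is_intercept f u v gamma d.
Hypothesis gamma_neq0 : forall k, gamma k != 0.
Hypothesis muI : mu I = 1%E.
Hypothesis density : has_piecewise_constant_density I u v mu.
Hypothesis invariant : invariant_on I f mu.

Let part : is_partition I u v. Proof. by case: markov. Qed.

(** Take for [phi] the dual weight and for [psi] the monomial of degree [j]. As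
    [j > 0], [phi] is orthogonal to constants on each cell, so it has mean zero
    and the correlation is just the integral bounded below. *)
Lemma mixing_rate_le_lyapunov (j : nat) (s : R) (Q : 'I_N -> {poly R})
    (c : R[i]) (r : R) :
  (0 < j)%N -> `|s| = 1 -> (forall k, gamma k ^+ j = s * `|gamma k| ^+ j) ->
  dual_weight u v j (piecewise_poly u v Q) (fun k => v k - u k) ->
  (mixing_rate mu I f (analytic_observables u v (ball (c : R[i]^o) r%:C)) <=
   (j%:R * lyapunov mu I f)%:E)%E.
Proof.
move=> j0 s1 gammas dualQ.
have mI := measurable_partition part.
have bQ := bounded_measurable_piecewise_poly Q part boundedI.
have [w dw] := cell_density_exists part density.
pose phi := piecewise_poly u v Q; pose psi := piecewise_poly u v (fun=> 'X^j).
apply: (@le_trans _ _ (decay_rate mu I f (fun x => (phi x)%:C)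
                                         (fun x => (psi x)%:C))).
  apply: ereal_inf_lbound.
  exists (fun x => (phi x)%:C, fun x => (psi x)%:C) => //.
  by split; exact: piecewise_poly_observable.
have phi0 : \int[mu]_(x in I) phi x = 0.
  rewrite (Rintegral_density part density dw) => [|k]; last first.
    exact: (bounded_measurableS mI (int_cell_subset part (k := k))).
  apply: big1 => k _.
  have s1j : (size (1%R : {poly R}) <= j.+1)%N by rewrite size_poly1.
  have := dualQ k _ s1j; rewrite coef1 gtn_eqF// mul0r => phik.
  rewrite (_ : \int[_]_(x in _) _ = 0) ?mulr0// -[RHS]phik.
  by apply: eq_Rintegral => x _; rewrite hornerC mul1r.
apply: decay_rate_le => n; first by rewrite correlation_real phi0 mul0r subr0.
apply: (correlation_lower_bound fI boundedI markov slopes intercept _ _ _ dw _ n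
  s1 gammas) => // k x xk.
by rewrite /psi (piecewise_polyE _ part xk) hornerXn.
Qed.

End MixingRate.

Theorem proposition2p2 (R : realType) (a b : R) (f : R -> R) (N : nat)
    (u v gamma d : 'I_N -> R) (c : R[i]) (r r' : R)
    (mu : probability (measurableTypeR R) R)
    (I := [set` `[a, b]] : set R)
    (H := analytic_observables u v (ball (c : R[i]^o) r'%:C)) :
  a < b ->
  (forall x, I x -> I (f x)) ->
  is_markov_partition I f u v ->
  expanding f u v ->
  piecewise_linear f u v gamma ->
  is_intercept f u v gamma d ->
  topologically_mixing f u v ->
  0 < r -> r < r' ->
  (forall k l, transition_matrix f u v l k = 1 ->
     inverse_branch gamma d l @` ball (c : R[i]^o) r'%:C
       `<=` ball (c : R[i]^o) r%:C) ->
  mu I = 1%E ->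
  has_piecewise_constant_density I u v mu ->
  invariant_on I f mu ->
  (mixing_rate mu I f H <= (2 * lyapunov mu I f)%:E)%E /\
  ((forall k l, Num.sg (gamma k) = Num.sg (gamma l)) ->
   (mixing_rate mu I f H <= (lyapunov mu I f)%:E)%E).
Proof.
move=> ab fI markov expand slopes intercept _ _ _ _ muI density invariant.
have part : is_partition I u v by case: markov.
have [uv _ _] := part.
have boundedI : bounded_measurable I id := bounded_measurable_id a b.
have gamma_neq0 k : gamma k != 0.
  have mid : int_cell u v k ((u k + v k) / 2).
    by rewrite int_cellE /= in_itv/=; have := uv k; lra.
  have [_] := expand k _ mid; have [_ ->] := slopes k _ mid.
  by apply: contraTneq => ->; rewrite normr0 ltr10.
have bound := @mixing_rate_le_lyapunov R I f N u v gamma d mu fI boundedI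
  markov slopes intercept gamma_neq0 muI density invariant.
split=> [|same_sign].
  apply: (bound 2 1 _ c r' isT (normr1 _)); last exact: dual_weight2 part.
  by move=> k; rewrite mul1r real_normK ?num_real.
have [k0] : exists k : 'I_N, true.
  have : I a by rewrite /I /= in_itv/= lexx ltW.
  by have [_ _ <-] := part => -[k _ _]; exists k.
move=> _; rewrite -[lyapunov mu I f]mul1r.
apply: (bound 1 (Num.sg (gamma k0)) _ c r' isT); last exact: dual_weight1 part.
  by rewrite normr_sg gamma_neq0.
by move=> k; rewrite !expr1 (same_sign k0 k) -numEsg.
Qed.
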